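(* Let $A\in\mathbb{R}^{n\times n}$ and $b\in\mathbb{R}^n$ be such that $(A,b)$ is controllable, let $p\in\mathbb{R}^n$ with $\|p\|=1$, and let $m(t)=p^\top e^{-At}b$, $t\ge 0$, be the corresponding switching function. Suppose that $m$ has a unique dominant oscillatory mode, that is, $m$ is a finite sum $$m(t)=\sum_{\nu}e^{\alpha_\nu t}t^{d_\nu}H_\nu\cos(\omega_\nu t+\phi_\nu),$$ with $\alpha_\nu,\phi_\nu\in\mathbb{R}$, $d_\nu\in\{0,1,2,\dots\}$, $H_\nu>0$, $\omega_\nu\ge 0$, and, with $\alpha:=\max_\nu\alpha_\nu$ and $k:=\max\{d_\nu:\alpha_\nu=\alpha\}$, there is exactly one index $\nu$ with $\alpha_\nu=\alpha$ and $d_\nu=k$, and its frequency $\Omega:=\omega_\nu$ is positive. Equivalently, $$m(t)=e^{\alpha t}\bigl(a\,t^k\cos(\Omega t+\psi)+P(t)\bigr),\qquad P(t)=o(t^k)\text{ as }t\to\infty,$$ where $a\neq 0$, $\Omega>0$, $\psi\in\mathbb{R}$, and $e^{\alpha t}P(t)$ is the sum of the remaining terms. Let $N(T,0)$ be the number of zeros of $m$ on $[0,T]$. Then $$\lim_{T\to\infty}\frac{N(T,0)}{T}=\frac{\Omega}{\pi}.$$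
   Context: The pair $(A,b)$ is controllable if $b,Ab,\dots,A^{n-1}b$ span $\mathbb{R}^n$. The function $m(t)=p^\top e^{-At}b$ is the (generic) switching function for the time-optimal control problem for $\dot x=Ax+bu$, $u(t)\in[-1,1]$. Its representation as a finite sum comes from a Jordan decomposition of $-A$; terms with $\omega_\nu=0$ represent contributions of real eigenvalues. *)

(* Defs.v *)
From HB Require Import structures.
From mathcomp Require Export all_boot all_order all_algebra.
From mathcomp Require Export all_classical all_reals all_analysis.
Export Order.TTheory GRing.Theory Num.Theory.
Export numFieldNormedType.Exports.

Set Implicit Arguments.
Unset Strict Implicit.
Unset Printing Implicit Defensive.

Local Open Scope classical_set_scope.
Local Open Scope ring_scope.

(* The vectors b, A b, ..., A^(n-1) b span the whole space. *)
Definition controllable (R : realType) (n : nat) (A : 'M[R]_n) (b : 'cV[R]_n)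
    : Prop :=
  (<< [seq A ^+ i *m b | i <- iota 0 n] >> = fullv)%VS.

(* The library's norm on matrices is the sup norm, hence this definition. *)
Definition euclidean_norm (R : realType) (n : nat) (p : 'cV[R]_n) : R :=
  Num.sqrt (\sum_(i < n) p i 0 ^+ 2).

(* The limit is taken in the (entrywise) topology of 'M[R]_n; the series
   converges for every A. *)
Definition expmx (R : realType) (n : nat) (A : 'M[R]_n) : 'M[R]_n :=
  limn (series (fun k : nat => (k`!%:R)^-1 *: A ^+ k)).

Definition switching_function (R : realType) (n : nat) (A : 'M[R]_n)
    (b p : 'cV[R]_n) (t : R) : R :=
  (p^T *m expmx (- t *: A) *m b) 0 0.

Definition is_maximum d (T : porderType d) (X : set T) (x : T) : Prop :=
  X x /\ ubound X x.

(* Only the values of m on [0, +oo[ are constrained.  The last condition says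
   that nu0 is the one and only index with growth rate a and degree k. *)
Definition unique_dominant_oscillatory_mode (R : realType) (m : R -> R)
    (Omega : R) : Prop :=
  exists (N : nat) (alpha H omega phi : 'I_N -> R) (d : 'I_N -> nat),
    [/\ forall nu, 0 < H nu,
        forall nu, 0 <= omega nu,
        forall t, 0 <= t ->
          m t = \sum_(nu < N) expR (alpha nu * t) * t ^+ d nu * H nu
                              * cos (omega nu * t + phi nu) &
        exists (a : R) (k : nat) (nu0 : 'I_N),
          [/\ is_maximum (range alpha) a,
              is_maximum [set d nu | nu in [set nu | alpha nu = a]] k,
              [set nu | alpha nu = a /\ d nu = k] = [set nu0],
              omega nu0 = Omega &
              0 < Omega]].

(* Distinct zeros are counted; the value is +oo if there are infinitely many,
   so that a finite limit of zero_count m T / T forces finiteness. *)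
Definition zero_count (R : realType) (m : R -> R) (T : R) : \bar R :=
  counting [set t : R | 0 <= t <= T /\ m t = 0].

(* Main.v *)
Require Import Defs.
From mathcomp Require Import finmap ring lra.

(** Past some time, the switching function is [expR (a * t) * t ^+ k * H] times
    [cos (Omega * t + phi) + r t], where both [r] and its derivative are
    [O(1/t)]. Between consecutive extrema of the cosine the perturbed function
    changes sign, and it vanishes only where the cosine is small, hence where
    it is strictly monotone: each such cell of length [pi / Omega] contains
    exactly one zero. On the initial segment the zeros are finitely many, since
    at a limit point of zeros all derivatives vanish by Rolle; as the
    derivatives of an exponential polynomial grow at most geometrically, it
    would then vanish from that point on. So the number of zeros on [0, T]
    differs from [T * Omega / pi] by a bounded amount. *)

Set Implicit Arguments.
Unset Strict Implicit.
Unset Printing Implicit Defensive.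

Local Open Scope classical_set_scope.
Local Open Scope ring_scope.

(** * Derivative rules in pointwise form; Rolle and mean value on closed intervals *)

Section Calculus.
Variable R : realType.
Implicit Types (f g r : R -> R) (x y a b c : R).

Lemma is_derive_addf f g x a b :
  is_derive x 1 f a -> is_derive x 1 g b ->
  is_derive x 1 (fun y => f y + g y) (a + b).
Proof. by move=> ? ?; exact: is_deriveD. Qed.

Lemma is_derive_mulf f g x a b :
  is_derive x 1 f a -> is_derive x 1 g b ->
  is_derive x 1 (fun y => f y * g y) (a * g x + f x * b).
Proof.
move=> fx gx; apply: is_derive_eq (is_deriveM fx gx) _.
by rewrite /GRing.scale /=; ring.
Qed.

Lemma is_derive_compf f g x a b :
  is_derive (g x) 1 f a -> is_derive x 1 g b ->
  is_derive x 1 (fun y => f (g y)) (a * b).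
Proof. by move=> ? ?; exact: is_derive1_comp. Qed.

Lemma is_derive_mulcf f x a c :
  is_derive x 1 f a -> is_derive x 1 (fun y => c * f y) (c * a).
Proof. by move=> fx; exact: (is_deriveZ c fx). Qed.

Lemma is_derive_expf f n x a : is_derive x 1 f a ->
  is_derive x 1 (fun y => f y ^+ n) (n%:R * f x ^+ n.-1 * a).
Proof.
move=> fx; have := is_deriveX n fx.
by rewrite (_ : f ^+ n = (fun y => f y ^+ n)) // funeqE => y; rewrite exprfctE.
Qed.

Lemma is_derive_affine x a b : is_derive x 1 (fun y => a * y + b) a.
Proof.
have /= := is_derive_addf (is_derive_mulcf a (is_derive_id x 1))
  (is_derive_cst b x (1 : R)).
by rewrite mulr1 addr0.
Qed.

Lemma is_derive_unique f x a b :
  is_derive x 1 f a -> is_derive x 1 f b -> a = b.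
Proof. by move=> [_ <-] [_ <-]. Qed.

Lemma is_derive_continuous_itv f df a b :
  (forall x, a <= x <= b -> is_derive x 1 f (df x)) ->
  {within `[a, b], continuous f}.
Proof.
move=> fdf; apply: derivable_within_continuous => x; rewrite in_itv /= => xab.
by case: (fdf x xab).
Qed.

(** Derivability up to the endpoints is assumed so that continuity on the closed interval comes for
    free at each use. *)
Lemma Rolle_closed f df a b : a < b ->
  (forall x, a <= x <= b -> is_derive x 1 f (df x)) -> f a = f b ->
  exists c, a < c < b /\ df c = 0.
Proof.
move=> ab fdf fab.
have [|c] := Rolle ab _ (is_derive_continuous_itv fdf) fab.
  move=> x; rewrite in_itv /= => /andP[ax xb].
  by case: (fdf x) => //; rewrite !ltW.
rewrite in_itv /= => cab dc; exists c; split => //.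
apply: (is_derive_unique (fdf _ _) dc).
by case/andP: cab => ac cb; rewrite !ltW.
Qed.

Lemma MVT_closed f df a b : a <= b ->
  (forall x, a <= x <= b -> is_derive x 1 f (df x)) ->
  exists c, a <= c <= b /\ f b - f a = df c * (b - a).
Proof.
move=> ab fdf.
have [|c] := MVT_segment (df := df) ab _ (is_derive_continuous_itv fdf).
  by move=> x; rewrite in_itv /= => /andP[ax xb]; apply: fdf; rewrite !ltW.
by rewrite in_itv /= => cab dc; exists c.
Qed.

End Calculus.

(** * The model cell: a perturbed cosine on [[0, pi]] *)

Lemma cos_perturbed_unique_zero (R : realType) (r dr : R -> R) :
  (forall x, 0 <= x <= pi -> is_derive x 1 r (dr x)) ->
  (forall x, 0 <= x <= pi -> `|r x| <= 2^-1) ->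
  (forall x, 0 <= x <= pi -> `|dr x| <= 2^-1) ->
  exists c, [/\ 0 < c < pi, cos c + r c = 0 &
    forall y, 0 <= y <= pi -> cos y + r y = 0 -> y = c].
Proof.
move=> rdr r_le dr_le; have pi0 : 0 <= pi :> R := pi_ge0 R.
pose f x := cos x + r x.
have fdf x : 0 <= x <= pi -> is_derive x 1 f (- sin x + dr x).
  by move=> /rdr ?; apply: is_derive_addf.
have f0 : 0 < f 0.
  rewrite /f cos0; have /r_le : 0 <= (0 : R) <= pi by rewrite lexx.
  rewrite ler_norml; lra.
have fpi : f pi < 0.
  rewrite /f cospi; have /r_le : 0 <= (pi : R) <= pi by rewrite lexx pi0.
  rewrite ler_norml; lra.
(* Rolle gives [c] between two zeros with [sin c = dr c <= 1/2]. At the zeros the cosine equals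
   [- r], so it lies in [[-1/2, 1/2]], and by monotonicity so does [cos c]. Then
   [cos c ^+ 2 + sin c ^+ 2 <= 1/2], which is absurd. *)
have uniq y z : 0 <= y -> y < z -> z <= pi -> f y = 0 -> f z = 0 -> False.
  move=> y0 yz zpi fy fz.
  have [|c [/andP[yc cz] dc]] :=
    Rolle_closed (df := fun x => - sin x + dr x) yz _
    (etrans fy (esym fz)).
  - move=> x /andP[yx xz]; apply: fdf.
    by rewrite (le_trans y0 yx) (le_trans xz zpi).
  have c0pi : 0 <= c <= pi by lra.
  have cosyc : cos c < cos y by rewrite ltr_cos // in_itv /= ?c0pi; lra.
  have coscz : cos z < cos c by rewrite ltr_cos // in_itv /= ?c0pi; lra.
  have := r_le y; have := r_le z; have := dr_le c c0pi.
  have := sin_ge0_pi c0pi; have := cos2Dsin2 c; move: fy fz; rewrite /f.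
  rewrite !ler_norml => fy fz cs2 s0 drc rz ry.
  have {}ry : - 2^-1 <= r y <= 2^-1 by apply: ry; lra.
  have {}rz : - 2^-1 <= r z <= 2^-1 by apply: rz; lra.
  have : sin c <= 2^-1 by lra.
  have : - 2^-1 <= cos c <= 2^-1 by lra.
  by nra.
have [|c] := IVT (v := 0) pi0 (is_derive_continuous_itv fdf).
  by rewrite minEle maxEle; case: ifP; lra.
rewrite in_itv /= => /andP[c0 cpi] fc; exists c; split=> //.
  apply/andP; split; rewrite lt_neqAle ?c0 ?cpi andbT; apply/eqP => E.
    by move: fc f0; rewrite -E => ->; rewrite ltxx.
  by move: fpi; rewrite -E fc ltxx.
move=> y /andP[y0 ypi] fy; have [||//] := ltgtP y c => yc; exfalso.
  exact: uniq y0 yc cpi fy fc.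
exact: uniq c0 yc ypi fc fy.
Qed.

(** * Finiteness of zeros on bounded intervals *)

Section FiniteZeros.
Variable R : realType.
Implicit Types (f : R -> R) (c t : R).

(* Every exponential polynomial has this property; [K] bounding the growth
   rate of the derivatives must not depend on the interval [0, T]. *)
Definition geometric_derivatives f : Prop :=
  exists (F : nat -> R -> R) (K : R),
    [/\ 0 <= K, F 0 = f, forall j t, is_derive t 1 (F j) (F j.+1 t) &
      forall T, exists C, forall j t, 0 <= t <= T -> `|F j t| <= C * K ^+ j].

(** Continuity gives [f c = 0]; Rolle between [c] and a nearby zero of [f] then yields a zero of the
    derivative that is closer to [c] and distinct from it. Iterating, all derivatives vanish at
    [c]. *)
Lemma limit_point_zeros_derive f df c :
  (forall t, is_derive t 1 f (df t)) ->
  limit_point [set t | f t = 0] c ->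
  f c = 0 /\ limit_point [set t | df t = 0] c.
Proof.
move=> fdf fc.
have fc0 : f c = 0.
  apply: contrapT => /eqP fcN0.
  have fcts : f @ c --> f c.
    by apply/differentiable_continuous/derivable1_diffP; case: (fdf c).
  have [y [_ fy0]] := fc _ (cvgr_neq0 _ fcts fcN0).
  by rewrite /= fy0 eqxx.
split=> // U /nbhs_ballP[e /= e0 eU].
have [y [yc fy0 cy]] := fc _ (nbhsx_ballx c e e0).
have {}cy : `|c - y| < e by [].
have [yltc|clty|] := ltgtP y c; last by move/eqP: yc.
- have [|d [/andP[yd dc] dfd]] := @Rolle_closed _ f df _ _ yltc.
    by rewrite fc0.
  exists d; split=> //; first by rewrite lt_eqF.
  by apply: eU; move: cy; rewrite /ball /= !ger0_norm; lra.
- have [|d [/andP[cd dy] dfd]] := @Rolle_closed _ f df _ _ clty.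
    by rewrite fc0.
  exists d; split=> //; first by rewrite gt_eqF.
  by apply: eU; move: cy; rewrite /ball /= !ltr0_norm; lra.
Qed.

Lemma le_geometric_eq0 (x C q : R) : 0 <= q <= 2^-1 ->
  (forall m, `|x| <= C * q ^+ m) -> x = 0.
Proof.
move=> /andP[q0 q2] xq; apply/eqP; rewrite -normr_eq0 -[_ == _]negbK.
apply/negP => xN0; have x0 : 0 < `|x| by rewrite lt_def xN0 normr_ge0.
have C0 : 0 <= C by have := xq 0%N; rewrite expr0 mulr1; exact: le_trans.
pose m := Num.bound (C / `|x|).
have Cm : C < `|x| * m%:R.
  rewrite mulrC -ltr_pdivrMr //; apply: le_lt_trans (archi_boundP _) => //.
  by rewrite divr_ge0.
have m2 : (m%:R : R) <= 2 ^+ m by rewrite -natrX ler_nat ltnW // ltn_expl.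
have : `|x| * 2 ^+ m <= C.
  rewrite -ler_pdivlMr ?exprn_gt0 //; apply: le_trans (xq m) _.
  by rewrite -exprVn ler_wpM2l // lerXn2r // nnegrE; lra.
apply/negP; rewrite -ltNge; apply: lt_le_trans Cm _.
by rewrite ler_wpM2l.
Qed.

Lemma limit_point_zeros_eventually0 f c : geometric_derivatives f -> 0 <= c ->
  limit_point [set t | f t = 0] c -> forall t, c <= t -> f t = 0.
Proof.
(* This choice makes [K * h <= 1/2]; the [+ 1] covers [K = 0]. Since [h] depends on [K] alone, the
   vanishing can be propagated by steps of fixed length. *)
move=> [F [K [K0 F0 FdF FK]]]; pose h := (2 * (K + 1))^-1.
have h0 : 0 < h by rewrite invr_gt0; lra.
have Kh : 0 <= K * h <= 2^-1.
  rewrite mulr_ge0 ?(ltW h0)//= /h invfM mulrCA ler_piMr //.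
  by rewrite ler_pdivrMr; lra.
have near0 x t : 0 <= x -> limit_point [set t | f t = 0] x ->
    x <= t <= x + h -> f t = 0.
  rewrite -F0 => x0 accx xth.
  have acc j : limit_point [set t | F j t = 0] x.
    elim: j => // j IHj; exact: (limit_point_zeros_derive (FdF j) IHj).2.
  have Fx0 j := (limit_point_zeros_derive (FdF j) (acc j)).1.
  have [C FC] := FK (x + h).
  apply: (le_geometric_eq0 (C := C) Kh) => m.
  (* The claim is stated for all [j] because the induction on [m] bounds [F j] through [F j.+1]: the
     mean value theorem from [x], where [F j] vanishes, gains a factor [h], and the extra power of
     [K] turns it into [K * h]. *)
  suff le j : `|F j t| <= C * K ^+ j * (K * h) ^+ m.
    by have := le 0%N; rewrite expr0 mulr1.
  elim: m j t xth => [|m IHm] j t /andP[xt th].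
    by rewrite expr0 mulr1 FC // (le_trans x0 xt).
  have [d [/andP[xd dt]]] := MVT_closed (df := F j.+1) xt (f := F j).
  rewrite Fx0 subr0 => ->; rewrite normrM (@ger0_norm _ (t - x)) ?subr_ge0 //.
  have -> : C * K ^+ j * (K * h) ^+ m.+1 = C * K ^+ j.+1 * (K * h) ^+ m * h.
    by rewrite !exprS; ring.
  apply: ler_pM; rewrite ?subr_ge0 //; last lra.
  by apply: IHm; rewrite xd (le_trans dt th).
move=> c0 accc t ct.
(* The step is [h / 2], not [h], so that the next point is interior to the interval where [f] is
   known to vanish and hence is again a limit point of zeros. *)
have acc n : limit_point [set t | f t = 0] (c + n%:R * (h / 2)).
  elim: n => [|n IHn]; first by rewrite mul0r addr0.
  have x0 : 0 <= c + n%:R * (h / 2).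
    by rewrite addr_ge0 // mulr_ge0 // divr_ge0 // ltW.
  set x := c + _ in IHn x0; have -> : c + n.+1%:R * (h / 2) = x + h / 2.
    by rewrite /x -natr1; ring.
  move=> U /nbhs_ballP[e /= e0 eU]; pose d := Num.min (e / 2) (h / 2).
  have d0 : 0 < d by rewrite lt_min !divr_gt0.
  have dh : d <= h / 2 by rewrite ge_min lexx orbT.
  have de : d <= e / 2 by rewrite ge_min lexx.
  exists (x + h / 2 + d); split.
  - by apply/eqP; lra.
  - by apply: (near0 x) => //; lra.
  - by apply: eU; rewrite /ball /= ltr0_norm; lra.
pose n := Num.truncn ((t - c) / (h / 2)).
have tc0 : 0 <= (t - c) / (h / 2) by rewrite !divr_ge0 ?subr_ge0 // ltW.
have /andP[] := truncn_itv tc0.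
rewrite -/n ler_pdivlMr ?divr_gt0 // ltr_pdivrMr ?divr_gt0 // => nt tn.
apply: (near0 (c + n%:R * (h / 2))) => //.
  by rewrite addr_ge0 // mulr_ge0 // divr_ge0 // ltW.
by move: tn; rewrite -natr1; lra.
Qed.

(** By Bolzano-Weierstrass, infinitely many zeros would accumulate at some [c], necessarily
    nonnegative, and [f] would vanish from [c] on. *)
Lemma finite_zeros f T : geometric_derivatives f ->
  (forall c, exists2 t, c <= t & f t != 0) ->
  finite_set [set t | 0 <= t <= T /\ f t = 0].
Proof.
move=> geof fN0; apply: contrapT => infZ.
set Z := [set t | _] in infZ.
have bZ : bounded_set Z.
  exists T; split; first exact: num_real.
  move=> M TM t [/andP[t0 tT] _]; rewrite /= ger0_norm //.
  exact: le_trans tT (ltW TM).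
have [c cZ] := infinite_bounded_limit_point_nonempty infZ bZ.
have c0 : 0 <= c.
  rewrite leNgt; apply/negP => c0.
  have Nc0 : 0 < - c by rewrite oppr_gt0.
  have [y [_ [/andP[y0 _] _]]] := cZ _ (nbhsx_ballx c _ Nc0).
  by rewrite /ball /= ltr_norml; lra.
have [t ct /eqP] := fN0 c; apply.
apply: limit_point_zeros_eventually0 c0 _ _ ct => // U cU.
by have [y [yc [_ fy] Uy]] := cZ _ cU; exists y.
Qed.

End FiniteZeros.

(** * Exponential polynomials have geometrically bounded derivatives *)

Section GeometricDerivatives.
Variable R : realType.
Implicit Types (f g : R -> R) (c t : R).

Lemma geometric_derivatives0 : geometric_derivatives (fun _ : R => 0 : R).
Proof.
exists (fun _ _ => 0), 0; split => // [j t|T]; first exact: is_derive_cst.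
by exists 0 => j t _; rewrite normr0 mul0r.
Qed.

Lemma geometric_derivativesZ c f : geometric_derivatives f ->
  geometric_derivatives (fun t => c * f t).
Proof.
move=> [F [K [K0 F0 FdF FK]]].
exists (fun j t => c * F j t), K; split => //.
- by rewrite -F0.
- by move=> j t; exact: is_derive_mulcf.
move=> T; have [C FC] := FK T; exists (`|c| * C) => j t /FC Fjt.
by rewrite normrM -mulrA ler_wpM2l.
Qed.

Lemma geometric_derivativesD f g :
  geometric_derivatives f -> geometric_derivatives g ->
  geometric_derivatives (fun t => f t + g t).
Proof.
move=> [F [K [K0 F0 FdF FK]]] [G [L [L0 G0 GdG GL]]].
exists (fun j t => F j t + G j t), (K + L); split => //.
- exact: addr_ge0.
- by rewrite -F0 -G0.
- by move=> j t; exact: is_derive_addf.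
move=> T; have [C FC] := FK T; have [D GD] := GL T.
exists (`|C| + `|D|) => j t tT; apply: le_trans (ler_normD _ _) _.
rewrite mulrDl lerD //.
  apply: le_trans (FC j t tT) _; apply: le_trans (ler_norm _) _.
  rewrite normrM ler_wpM2l // ger0_norm ?exprn_ge0 //.
  by rewrite lerXn2r ?nnegrE //; lra.
apply: le_trans (GD j t tT) _; apply: le_trans (ler_norm _) _.
rewrite normrM ler_wpM2l // ger0_norm ?exprn_ge0 //.
by rewrite lerXn2r ?nnegrE //; lra.
Qed.

Lemma geometric_derivatives_sum (I : Type) (s : seq I) (F : I -> R -> R) :
  (forall i, geometric_derivatives (F i)) ->
  geometric_derivatives (fun t => \sum_(i <- s) F i t).
Proof.
move=> geoF; elim: s => [|i s IHs].
  by under eq_fun do rewrite big_nil; exact: geometric_derivatives0.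
by under eq_fun do rewrite big_cons; exact: geometric_derivativesD.
Qed.

(** The left side is one term of the binomial expansion of the right side. It absorbs the factor [j]
    that the Leibniz rule produces on multiplication by [t]. *)
Lemma natr_expr_pred_le (K : R) j : 0 <= K ->
  j%:R * K ^+ j.-1 <= (K + 1) ^+ j.
Proof.
move=> K0; elim: j => [|j IHj]; first by rewrite mul0r.
have -> : j.+1%:R * K ^+ j.+1.-1 = K * (j%:R * K ^+ j.-1) + K ^+ j.
  by rewrite -natr1; case: j {IHj} => [|j]; rewrite /= ?exprS; ring.
rewrite [leRHS]exprS mulrDl mul1r lerD ?ler_wpM2l //.
by rewrite lerXn2r ?nnegrE; lra.
Qed.

Lemma geometric_derivativesX f : geometric_derivatives f ->
  geometric_derivatives (fun t => t * f t).
Proof.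
move=> [F [K [K0 F0 FdF FK]]].
(* Leibniz rule for [t * f t]. For [j = 0] the index [j.-1] is a dummy, since its coefficient is
   zero. *)
exists (fun j t => t * F j t + j%:R * F j.-1 t), (K + 1); split => //.
- exact: addr_ge0.
- by apply/funext => t; rewrite mul0r addr0 F0.
- move=> j t.
  have := is_derive_addf (is_derive_mulf (is_derive_id t (1 : R)) (FdF j t))
    (is_derive_mulcf j%:R (FdF j.-1 t)).
  move=> /is_derive_eq; apply; rewrite -natr1.
  by case: j => [|j] /=; ring.
move=> T; have [C FC] := FK T.
exists ((T + 1) * C) => j t tT; have /andP[t0 tleT] := tT.
have C0 : 0 <= C.
  have := FC 0%N t tT; rewrite expr0 mulr1; exact: le_trans (normr_ge0 _).
apply: le_trans (ler_normD _ _) _; rewrite !mulrDl mul1r !normrM lerD //.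
  rewrite (ger0_norm t0) -mulrA ler_pM //; apply: le_trans (FC _ _ tT) _.
  by rewrite ler_wpM2l // lerXn2r ?nnegrE; lra.
rewrite ger0_norm ?ler0n //.
apply: (@le_trans _ _ (j%:R * (C * K ^+ j.-1))).
  by rewrite ler_wpM2l // FC.
by rewrite mulrCA ler_wpM2l // natr_expr_pred_le.
Qed.

Lemma is_derive_expR_lin (a t : R) :
  is_derive t 1 (fun t => expR (a * t)) (a * expR (a * t)).
Proof.
have := is_derive_compf (is_derive_expR (a * t))
  (is_derive_mulcf a (is_derive_id t (1 : R))).
by move=> /is_derive_eq; apply; rewrite mulr1 mulrC.
Qed.

Lemma is_derive_cos_affine (w p t : R) :
  is_derive t 1 (fun t => cos (w * t + p)) (- w * sin (w * t + p)).
Proof.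
have := is_derive_compf (g := fun t => w * t + p)
  (is_derive_cos (w * t + p)) (is_derive_affine t w p).
by move=> /is_derive_eq; apply; ring.
Qed.

Lemma is_derive_sin_affine (w p t : R) :
  is_derive t 1 (fun t => sin (w * t + p)) (w * cos (w * t + p)).
Proof.
have := is_derive_compf (g := fun t => w * t + p)
  (is_derive_sin (w * t + p)) (is_derive_affine t w p).
by move=> /is_derive_eq; apply; ring.
Qed.

Lemma geometric_derivatives_osc (a w p : R) :
  geometric_derivatives (fun t => expR (a * t) * cos (w * t + p)).
Proof.
(* The pair holds the coefficients of cosine and sine in the derivative of order [j]. One
   differentiation multiplies the sum of their absolute values by at most [|a| + |w|], whence the
   geometric rate. *)
pose co j : R * R :=
  iter j (fun z => (a * z.1 + w * z.2, a * z.2 - w * z.1)) (1, 0).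
pose F j t :=
  expR (a * t) * ((co j).1 * cos (w * t + p) + (co j).2 * sin (w * t + p)).
exists F, (`|a| + `|w|); split => //.
- by apply/funext => t; rewrite /F /=; ring.
- move=> j t.
  have := is_derive_mulf (is_derive_expR_lin a t) (is_derive_addf
    (is_derive_mulcf (co j).1 (is_derive_cos_affine w p t))
    (is_derive_mulcf (co j).2 (is_derive_sin_affine w p t))).
  move=> /is_derive_eq; apply; rewrite /F /=.
  by move: (co j) => z; ring.
have co_le j : `|(co j).1| + `|(co j).2| <= (`|a| + `|w|) ^+ j.
  elim: j => [|j IHj]; first by rewrite /= normr1 normr0 addr0.
  rewrite exprS /=; move: (co j) IHj => z IHj.
  apply: (@le_trans _ _ ((`|a| + `|w|) * (`|z.1| + `|z.2|))); last first.
    by rewrite ler_wpM2l ?addr_ge0.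
  have := ler_normD (a * z.1) (w * z.2).
  have := ler_normB (a * z.2) (w * z.1).
  by rewrite !normrM; lra.
move=> T; exists (expR (`|a| * T)) => j t /andP[t0 tT].
rewrite /F normrM (ger0_norm (expR_ge0 _)) ler_pM ?expR_ge0 //.
  rewrite ler_expR (le_trans (ler_norm _)) // normrM (ger0_norm t0).
  by rewrite ler_wpM2l.
apply: le_trans (co_le j); apply: le_trans (ler_normD _ _) _.
rewrite !normrM lerD // ler_piMr ?cos_max //.
by rewrite ler_norml sin_geN1 sin_le1.
Qed.

Lemma geometric_derivatives_mode (a h w p : R) d :
  geometric_derivatives
    (fun t => expR (a * t) * t ^+ d * h * cos (w * t + p)).
Proof.
elim: d => [|d IHd].
  have := geometric_derivativesZ h (geometric_derivatives_osc a w p).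
  by congr geometric_derivatives; apply/funext => t; ring.
have := geometric_derivativesX IHd.
by congr geometric_derivatives; apply/funext => t; rewrite exprS; ring.
Qed.

End GeometricDerivatives.

(** * Decay of the dominated modes relative to the dominant one *)

Section InverseDecay.
Variable R : realType.
Implicit Types (f g r : R -> R) (c t : R).

(** The derivative is controlled too, because uniqueness of the zero in a cell depends on it.
    Starting at [1] avoids the singularity at [0] and gives [t^-1 <= 1]. *)
Definition inverse_decay r : Prop :=
  exists (dr : R -> R) (C : R), forall t, 1 <= t ->
    [/\ is_derive t 1 r (dr t), `|r t| <= C / t & `|dr t| <= C / t].

Lemma inverse_decayZ c f : inverse_decay f -> inverse_decay (fun t => c * f t).
Proof.
move=> [df [C fC]]; exists (fun t => c * df t), (`|c| * C) => t /fC[fdf ft dft].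
by split; [exact: is_derive_mulcf| |]; rewrite normrM -mulrA ler_wpM2l.
Qed.

Lemma inverse_decayD f g : inverse_decay f -> inverse_decay g ->
  inverse_decay (fun t => f t + g t).
Proof.
move=> [df [C fC]] [dg [D gD]]; exists (fun t => df t + dg t), (C + D) => t t1.
have [fdf ft dft] := fC t t1; have [gdg gt dgt] := gD t t1.
by split; [exact: is_derive_addf| |];
  rewrite mulrDl (le_trans (ler_normD _ _)) // lerD.
Qed.

Lemma inverse_decay_sum (I : Type) (s : seq I) (P : pred I) (F : I -> R -> R) :
  (forall i, P i -> inverse_decay (F i)) ->
  inverse_decay (fun t => \sum_(i <- s | P i) F i t).
Proof.
move=> decF; elim: s => [|i s IHs].
  under eq_fun do rewrite big_nil.
  exists (fun=> 0), 0 => t _.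
  by split; [exact: is_derive_cst| |]; rewrite normr0 mul0r.
under eq_fun do rewrite big_cons.
case Pi: (P i) => //; apply: inverse_decayD => //; exact: decF.
Qed.

(** The two cases are the two ways to be dominated: a smaller growth rate, or the same rate with a
    smaller degree. The second is a comparison of powers. *)
Lemma dominated_envelope_le (b : R) (d k : nat) :
  b < 0 \/ (b = 0 /\ (d < k)%N) ->
  exists C, forall t, 1 <= t -> expR (b * t) * t ^+ d * t^-1 ^+ k <= C / t.
Proof.
case=> [b0|[-> dk]]; last first.
  exists 1 => t t1; rewrite mul0r expR0 mul1r.
  have t0 : t != 0 by rewrite gt_eqF //; lra.
  have ti0 : 0 <= t^-1 by rewrite invr_ge0; lra.
  have ti1 : t^-1 <= 1 by rewrite invf_le1; lra.
  rewrite -(subnKC dk) addSn exprS exprD mulrCA [t ^+ d * _]mulrA -exprMn.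
  rewrite divff // expr1n !mul1r ler_piMr // exprn_ile1 //.
(* The constant comes from [x ^+ d.+1 / d.+1! <= expR x] at [x = - (b * t)]; the exponent [d.+1]
   leaves one spare factor [1 / t]. *)
exists (d.+1`!%:R / (- b) ^+ d.+1) => t t1.
have t0 : 0 < t by lra.
have bt0 : 0 < - (b * t) by rewrite -mulNr mulr_gt0 // oppr_gt0.
have fact0 : 0 < d.+1`!%:R :> R by rewrite ltr0n fact_gt0.
apply: (@le_trans _ _ (expR (b * t) * t ^+ d)).
  rewrite ler_piMr ?mulr_ge0 ?expR_ge0 ?exprn_ge0 ?(ltW t0) //.
  by rewrite exprn_ile1 ?invr_ge0 ?(ltW t0) // invf_le1.
have : (- (b * t)) ^+ d.+1 / d.+1`!%:R <= expR (- (b * t)).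
  by have := expR_ge1Dxn d (ltW bt0); lra.
rewrite expRN ler_pdivrMr // => le.
rewrite ler_pdivlMr // ler_pdivlMr ?exprn_gt0 ?oppr_gt0 //.
have -> : expR (b * t) * t ^+ d * t * (- b) ^+ d.+1 =
    (- (b * t)) ^+ d.+1 * expR (b * t).
  by rewrite -mulNr exprMn (exprSr t); ring.
by rewrite -ler_pdivlMr ?expR_gt0 // [leRHS]mulrC.
Qed.

Lemma inverse_decay_mode (b w p : R) (d k : nat) :
  b < 0 \/ (b = 0 /\ (d < k)%N) ->
  inverse_decay
    (fun t => expR (b * t) * t ^+ d * t^-1 ^+ k * cos (w * t + p)).
Proof.
move=> /dominated_envelope_le[C EC].
pose E t := expR (b * t) * t ^+ d * t^-1 ^+ k.
(* The factor of the cosine is the logarithmic derivative of the envelope [E], bounded for [t >= 1];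
   so the derivative inherits the decay of [E]. *)
pose dr t := E t * ((b + (d%:R - k%:R) * t^-1) * cos (w * t + p)
                    - w * sin (w * t + p)).
have C0 : 0 <= C.
  have := EC 1 (lexx 1); rewrite divr1; apply: le_trans.
  by rewrite invr1 !expr1n !mulr1 expR_ge0.
pose D : R := 1 + `|b| + d%:R + k%:R + `|w|.
have cond0 : 0 <= `|b| + d%:R + k%:R + `|w| by rewrite !addr_ge0.
exists dr, (C * D) => t t1.
have t0 : 0 < t by lra.
have ti0 : 0 < t^-1 by rewrite invr_gt0.
have ti1 : t^-1 <= 1 by rewrite invf_le1.
have E0 : 0 <= E t.
  by rewrite !mulr_ge0 ?expR_ge0 ?exprn_ge0 ?(ltW t0) // ltW.
have absE (y B : R) : `|y| <= B -> B <= D -> `|E t * y| <= C * D / t.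
  move=> yB BD; rewrite normrM (ger0_norm E0) (mulrAC C) ler_pM ?EC //.
  exact: le_trans yB BD.
have cos1 := cos_max (w * t + p).
have sin1 : `|sin (w * t + p)| <= 1 by rewrite ler_norml sin_geN1 sin_le1.
split.
- have tN0 : t != 0 by rewrite gt_eqF.
  have := is_derive_mulf (is_derive_mulf (is_derive_mulf
    (is_derive_expR_lin b t) (is_derive_expf d (is_derive_id t (1 : R))))
    (is_derive_expf k (is_deriveV tN0 (is_derive_id t (1 : R)))))
    (is_derive_cos_affine w p t).
  move=> /is_derive_eq; apply; rewrite /dr /E /= /GRing.scale /=.
  have -> : d%:R * t ^+ d.-1 * 1 = d%:R * t ^+ d * t^-1.
    by case: (d) => [|m]; rewrite ?mul0r // exprSr /=; field.
  have -> : k%:R * t^-1 ^+ k.-1 * (- t ^- 2 * 1) = - k%:R * t^-1 ^+ k * t^-1.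
    rewrite -exprVn; case: (k) => [|m] /=; first by rewrite oppr0 !mul0r.
    by rewrite (exprSr _ m); ring.
  by ring.
- apply: (absE _ 1) => //; rewrite /D; lra.
- apply: (absE _ (`|b| + d%:R + k%:R + `|w|)); last by rewrite /D; lra.
  apply: le_trans (ler_normB _ _) _; rewrite !normrM lerD //; last first.
    by rewrite ler_piMr.
  apply: le_trans (ler_piMr _ cos1) _ => //.
  apply: le_trans (ler_normD _ _) _; rewrite -addrA lerD // normrM.
  rewrite (ger0_norm (ltW ti0)); apply: le_trans (ler_piMr _ ti1) _ => //.
  by apply: le_trans (ler_normB _ _) _; rewrite !ger0_norm.
Qed.

End InverseDecay.

(** * One zero in each cell between consecutive extrema of the cosine *)

Section CountingZeros.
Variables (R : realType) (Omega phi : R).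
Hypothesis Omega_gt0 : 0 < Omega.

(* The points where [cos (Omega * t + phi)] equals [(-1) ^ j]. *)
Definition cos_extremum (j : nat) : R := (j%:R * pi - phi) / Omega.

Lemma cos_extremumS j : cos_extremum j.+1 = cos_extremum j + pi / Omega.
Proof. by rewrite /cos_extremum -natr1; ring. Qed.

Lemma cos_extremumD j n :
  cos_extremum (j + n) = cos_extremum j + n%:R * (pi / Omega).
Proof. by rewrite /cos_extremum natrD; ring. Qed.

Lemma cos_extremum_ge (M : R) :
  exists J, forall j, (J <= j)%N -> M <= cos_extremum j.
Proof.
pose x := (M * Omega + phi) / pi; exists (Num.bound `|x|) => j Jj.
have xj : x < j%:R.
  apply: le_lt_trans (ler_norm _) _.
  apply: lt_le_trans (archi_boundP _) _ => //.
  by rewrite ler_nat.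
rewrite /cos_extremum ler_pdivlMr //.
by move: xj; rewrite ltr_pdivrMr ?pi_gt0 //; lra.
Qed.

Lemma cos_perturbed_cells (r : R -> R) : inverse_decay r ->
  exists2 J, 1 <= cos_extremum J & forall j, (J <= j)%N ->
    exists2 c, cos_extremum j < c < cos_extremum j.+1 &
      forall t, cos_extremum j <= t <= cos_extremum j.+1 ->
        cos (Omega * t + phi) + r t = 0 <-> t = c.
Proof.
move=> [dr [C rC]].
(* Beyond [M] both [r] and [dr / Omega] are at most [1/2] in absolute value; the division by [Omega]
   comes from rescaling the cell. The summand [1] keeps the cells in the domain of the decay
   bounds. *)
pose M : R := 1 + 2 * `|C| + 2 * (`|C| / Omega).
have C0 : 0 <= `|C| / Omega by rewrite divr_ge0 // ltW.
have M1 : 1 <= M by rewrite /M; have := normr_ge0 C; lra.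
have [J MJ] := cos_extremum_ge M; exists J.
  by apply: le_trans M1 _; exact: MJ.
move=> j /MJ Mj.
have OmN0 : Omega != 0 by rewrite gt_eqF.
(* Affine map of [[0, pi]] onto cell [j]. There the cosine becomes [(-1) ^+ j * cos s], and moving
   the sign onto the perturbation reduces to the model cell. *)
pose tau (s : R) : R := (s + j%:R * pi - phi) / Omega.
have tauE s : Omega * tau s + phi = s + pi *+ j.
  by rewrite /tau -[pi *+ j]mulr_natl; field.
have tauM (s : R) : 0 <= s -> M <= tau s.
  by move=> s0; apply: le_trans Mj _; rewrite ler_pM2r ?invr_gt0 //; lra.
have dtau (s : R) : is_derive s 1 tau Omega^-1.
  have := is_derive_affine s Omega^-1 ((j%:R * pi - phi) / Omega).
  by congr is_derive; apply/funext => x; rewrite /tau; ring.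
have small (s y : R) : 0 <= s -> `|y| <= C / tau s ->
    `|y| <= 2^-1 /\ `|y / Omega| <= 2^-1.
  move=> s0 yC; have taus := tauM s s0; have tau0 : 0 < tau s by lra.
  have {}yC : `|y| <= `|C| / tau s.
    by apply: le_trans yC _; rewrite ler_wpM2r ?ler_norm // invr_ge0 ltW.
  split.
    apply: le_trans yC _; rewrite ler_pdivrMr //.
    by move: taus; rewrite /M; lra.
  rewrite normrM normfV (ger0_norm (ltW Omega_gt0)) ler_pdivrMr //.
  apply: le_trans yC _; rewrite ler_pdivrMr // -ler_pdivrMl ?mulr_gt0 //.
  have -> : (2^-1 * Omega)^-1 * `|C| = 2 * (`|C| / Omega) by field.
  by move: taus; rewrite /M; have := normr_ge0 C; lra.
pose rho s := (-1) ^+ j * r (tau s).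
pose drho s := (-1) ^+ j * (dr (tau s) * Omega^-1).
have [||| c [c0pi fc cuniq]] := @cos_perturbed_unique_zero R rho drho.
- move=> s /andP[s0 _]; apply: is_derive_mulcf.
  have [|rdr _ _] := rC (tau s); first exact: le_trans M1 (tauM s s0).
  exact: is_derive_compf.
- move=> s /andP[s0 _]; rewrite normrMsign.
  have [|_ rt _] := rC (tau s); first exact: le_trans M1 (tauM s s0).
  exact: (small s _ s0 rt).1.
- move=> s /andP[s0 _]; rewrite normrMsign.
  have [|_ _ drt] := rC (tau s); first exact: le_trans M1 (tauM s s0).
  exact: (small s _ s0 drt).2.
have fE s : cos (Omega * tau s + phi) + r (tau s) = (-1) ^+ j * (cos s + rho s).
  rewrite tauE (alternatingn (@cosDpi R)) /rho mulrDr mulrA -expr2 sqrr_sign.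
  by rewrite mul1r.
have tau0 : cos_extremum j = tau 0 by rewrite /tau add0r.
have taupi : cos_extremum j.+1 = tau pi.
  by rewrite /cos_extremum /tau -natr1; ring.
have ltr_tau s s' : (tau s < tau s') = (s < s').
  by rewrite /tau ltr_pM2r ?invr_gt0 // !ltrD2r.
have ler_tau s s' : (tau s <= tau s') = (s <= s').
  by rewrite /tau ler_pM2r ?invr_gt0 // !lerD2r.
exists (tau c); first by rewrite tau0 taupi !ltr_tau.
move=> t; have -> : t = tau (Omega * t + phi - j%:R * pi).
  by rewrite /tau; field.
set s := _ - _; rewrite tau0 taupi !ler_tau => s0pi; rewrite fE; split.
  by move/eqP; rewrite mulf_eq0 signr_eq0 /= => /eqP /(cuniq s s0pi) ->.
move=> tsc; have -> : s = c.
  by apply/eqP; rewrite eq_le -(ler_tau s) -(ler_tau c) tsc lexx.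
by rewrite fc mulr0.
Qed.

(** * Counting zeros cell by cell *)

Section Count.
Variables (u : R -> R) (J : nat).
Hypothesis J_ge1 : 1 <= cos_extremum J.
Hypothesis cells : forall j, (J <= j)%N ->
  exists2 c, cos_extremum j < c < cos_extremum j.+1 &
    forall t, cos_extremum j <= t <= cos_extremum j.+1 -> u t = 0 <-> t = c.

Let cell_pos : 0 < pi / Omega.
Proof. by rewrite divr_gt0 ?pi_gt0. Qed.

(** The only zero of a cell is interior, so [u] is nonzero at the extrema, which go to infinity. *)
Lemma cells_not_eventually0 c : exists2 t, c <= t & u t != 0.
Proof.
have [J' J'c] := cos_extremum_ge c.
pose j := maxn J J'; have cj := J'c j (leq_maxr _ _).
have [d jd ud] := cells (leq_maxl J J'); rewrite -/j in jd ud.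
exists (cos_extremum j) => //; apply/eqP => uj0.
have : cos_extremum j = d.
  by apply/ud; rewrite // lexx ltW // cos_extremumS ltrDl.
by lra.
Qed.

Hypothesis finite_u : forall T, finite_set [set t | 0 <= t <= T /\ u t = 0].

Let N (T : R) : nat := #|` fset_set [set t | 0 <= t <= T /\ u t = 0]|%fset.

Let zero_countE T : zero_count u T = (N T)%:R%:E.
Proof. by rewrite /zero_count /counting asboolT. Qed.

Let N_mono S T : S <= T -> (N S <= N T)%N.
Proof.
move=> ST; apply/fsubset_leq_card; rewrite -fset_set_sub //.
by move=> t [/andP[t0 tS] ut] /=; rewrite t0 (le_trans tS ST).
Qed.

(** Passing through a cell adds exactly its zero [c], which is new because it lies strictly beyond
    the left endpoint. *)
Let NS j : (J <= j)%N -> N (cos_extremum j.+1) = (N (cos_extremum j)).+1.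
Proof.
move=> Jj; have [c /andP[jc cj] uc] := cells Jj.
have j1 : 1 <= cos_extremum j.
  rewrite -(subnKC Jj) cos_extremumD; apply: le_trans J_ge1 _.
  by rewrite lerDl mulr_ge0 // ltW.
rewrite /N; set Z := [set t | 0 <= t <= cos_extremum j /\ _].
have -> : [set t | 0 <= t <= cos_extremum j.+1 /\ u t = 0] = c |` Z.
  apply/seteqP; split => t.
    move=> [/andP[t0 tj] ut]; have [tlej|jlet] := leP t (cos_extremum j).
      by right; split=> //; rewrite t0.
    by left; apply/uc => //; rewrite (ltW jlet).
  case=> [->|[/andP[t0 tj] ut]] /=.
    split; first by rewrite (ltW cj) andbT; lra.
    by apply/uc => //; rewrite !ltW.
  by split=> //; rewrite t0 (le_trans tj) // cos_extremumS lerDl ltW.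
rewrite fset_setU1; last exact: finite_u.
rewrite cardfsU1 in_fset_set; last exact: finite_u.
case: (boolP (c \in Z)) => //= /set_mem[/andP[_ cj'] _].
by move: jc; rewrite ltNge cj'.
Qed.

Let ND n : N (cos_extremum (J + n)) = (N (cos_extremum J) + n)%N.
Proof.
elim: n => [|n IHn]; first by rewrite !addn0.
by rewrite !addnS NS ?IHn // leq_addr.
Qed.

Lemma zero_count_bounded_discrepancy :
  exists D, forall T, cos_extremum J <= T ->
    exists2 x, zero_count u T = x%:E & `|x - T * (Omega / pi)| <= D.
Proof.
have pi0 : 0 < pi :> R := pi_gt0 R.
pose N0 := N (cos_extremum J).
(* The three terms account for the zeros up to the first good cell, the length of that initial
   segment measured in cells, and the incomplete cell containing [T]. *)
exists (N0%:R + cos_extremum J * (Omega / pi) + 1) => T JT.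
exists (N T)%:R; first exact: zero_countE.
pose y := (T - cos_extremum J) / (pi / Omega).
have y0 : 0 <= y by rewrite divr_ge0 ?subr_ge0 // ltW.
have yE : y = T * (Omega / pi) - cos_extremum J * (Omega / pi).
  by rewrite /y; move: (pi : R) pi0 => P P0; field; rewrite !gt_eqF.
have /andP[] := truncn_itv y0; set n := Num.truncn y => ny yn.
have Nlo : (N0 + n <= N T)%N.
  rewrite -ND; apply: N_mono; rewrite cos_extremumD.
  by move: ny; rewrite /y ler_pdivlMr //; lra.
have Nhi : (N T <= N0 + n.+1)%N.
  rewrite -ND; apply: N_mono; rewrite cos_extremumD.
  by move: yn; rewrite /y ltr_pdivrMr //; lra.
move: Nlo Nhi; rewrite -(ler_nat R) -[in X in _ -> X -> _](ler_nat R).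
rewrite !natrD -[in X in _ -> X -> _]natr1 => Nlo Nhi.
have J0 : 0 <= cos_extremum J * (Omega / pi).
  by apply: mulr_ge0; [exact: le_trans J_ge1|apply: divr_ge0; exact: ltW].
move: yn; rewrite -natr1 => yn.
have N00 : 0 <= N0%:R :> R by [].
by rewrite ler_norml; lra.
Qed.

End Count.
End CountingZeros.

(** * Passage to the limit and assembly *)

Lemma bounded_discrepancy_cvg (R : realType) (f : R -> \bar R) (l D M : R) :
  (forall T, M <= T -> exists2 x, f T = x%:E & `|x - T * l| <= D) ->
  (f T * (T^-1)%:E)%E @[T --> +oo] --> l%:E.
Proof.
move=> fD.
have inv0 : (D * T^-1) @[T --> +oo] --> (0 : R).
  rewrite -(mulr0 D); apply: cvgMr.
  by apply/gtr0_cvgV0; [exact: nbhs_pinfty_gt|exact: cvg_id].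
apply: (@squeeze_cvge _ _ _ _ (fun T => (l - D * T^-1)%:E) _
    (fun T => (l + D * T^-1)%:E)).
- near=> T.
  have T0 : 0 < T by near: T; apply: nbhs_pinfty_gt; exact: num_real.
  have /fD[x -> xD] : M <= T by near: T; apply: nbhs_pinfty_ge; exact: num_real.
  rewrite -EFinM !lee_fin; move: xD; rewrite ler_norml => xD.
  have TN0 : T != 0 by rewrite gt_eqF.
  have -> : l - D * T^-1 = (T * l - D) / T by field.
  have -> : l + D * T^-1 = (T * l + D) / T by field.
  by rewrite !ler_pM2r ?invr_gt0 //; lra.
- apply: cvg_EFin; first exact: nearW.
  by rewrite -[X in _ --> X]subr0; apply: cvgB => //; exact: cvg_cst.
- apply: cvg_EFin; first exact: nearW.
  by rewrite -[X in _ --> X]addr0; apply: cvgD => //; exact: cvg_cst.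
Unshelve. all: by end_near.
Qed.

(** Dividing by the dominant envelope, possible for [t > 0], leaves modes with rate [alpha nu - a]
    and powers [t ^+ d nu * t^-1 ^+ k]. Each is dominated, since equal rate and degree would force
    [nu = nu0]. *)
Lemma dominant_mode_factor (R : realType) (N : nat)
    (alpha H omega phi : 'I_N -> R) (d : 'I_N -> nat) (a : R) (k : nat)
    (nu0 : 'I_N) :
  (forall nu, 0 < H nu) ->
  is_maximum (range alpha) a ->
  is_maximum [set d nu | nu in [set nu | alpha nu = a]] k ->
  [set nu | alpha nu = a /\ d nu = k] = [set nu0] ->
  exists2 r, inverse_decay r & forall t, 0 < t ->
    \sum_(nu < N) expR (alpha nu * t) * t ^+ d nu * H nu
                  * cos (omega nu * t + phi nu) =
    expR (a * t) * t ^+ k * H nu0 * (cos (omega nu0 * t + phi nu0) + r t).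
Proof.
move=> H0 [_ amax] [_ kmax] nu0P.
have [a0 k0] : alpha nu0 = a /\ d nu0 = k.
  by have : [set nu0] nu0 by []; rewrite -nu0P.
exists (fun t => \sum_(nu < N | nu != nu0) H nu / H nu0 *
    (expR ((alpha nu - a) * t) * t ^+ d nu * t^-1 ^+ k
     * cos (omega nu * t + phi nu))).
  apply: inverse_decay_sum => nu nuN0; apply: inverse_decayZ.
  apply: inverse_decay_mode.
  have := amax _ (imageT alpha nu); rewrite le_eqVlt.
  case/orP=> [/eqP nua|]; last first.
    by rewrite -subr_lt0; left.
  right; split; first by rewrite nua subrr.
  have : (d nu <= k)%N by apply: kmax; exists nu.
  rewrite leq_eqVlt => /orP[/eqP nuk|//].
  have : [set nu | alpha nu = a /\ d nu = k] nu by [].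
  by rewrite nu0P => /eqP; rewrite (negbTE nuN0).
move=> t t0; have tN0 : t != 0 by rewrite gt_eqF.
have HN0 : H nu0 != 0 by rewrite gt_eqF.
rewrite (bigD1 nu0) //= a0 k0 mulrDr; congr (_ + _).
rewrite mulr_sumr; apply: eq_bigr => nu _.
have -> : expR (alpha nu * t) = expR (a * t) * expR ((alpha nu - a) * t).
  by rewrite -expRD; congr expR; ring.
by rewrite exprVn; field; rewrite HN0 expf_neq0.
Qed.

Theorem mainTheorem3 (R : realType) (n : nat) (A : 'M[R]_n) (b p : 'cV[R]_n)
    (Omega : R) :
  controllable A b ->
  euclidean_norm p = 1 ->
  unique_dominant_oscillatory_mode (switching_function A b p) Omega ->
  (zero_count (switching_function A b p) T * (T^-1)%:E)%E @[T --> +oo]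
    --> (Omega / pi)%:E.
Proof.
move=> _ _ [N [alpha [H [omega [phi [d [H0 _ mE]]]]]]].
case=> a [k [nu0 [amax kmax nu0P <- Omega0]]].
move: (switching_function A b p) mE => m mE.
(* The sum agrees with [m] only for [t >= 0], which suffices for counting; unlike [m], it is known
   to be smooth on the whole line, as the finiteness argument requires. *)
pose u t := \sum_(nu < N) expR (alpha nu * t) * t ^+ d nu * H nu
                          * cos (omega nu * t + phi nu).
have -> : zero_count m = zero_count u.
  apply/funext => T; congr counting; apply/seteqP; split => t /= [t0T];
    by have /andP[t0 _] := t0T; rewrite mE.
have [r rdec uE] := dominant_mode_factor omega phi H0 amax kmax nu0P.
have [J J1 cells] := cos_perturbed_cells (phi nu0) Omega0 rdec.
have ucells j : (J <= j)%N ->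
    exists2 c, cos_extremum (omega nu0) (phi nu0) j < c
                 < cos_extremum (omega nu0) (phi nu0) j.+1 &
      forall t, cos_extremum (omega nu0) (phi nu0) j <= t
                  <= cos_extremum (omega nu0) (phi nu0) j.+1 ->
        u t = 0 <-> t = c.
  move=> Jj; have [c cj cP] := cells j Jj; exists c => // t tj.
  have t0 : 0 < t.
    case/andP: tj => jt _; apply: lt_le_trans jt; apply: lt_le_trans ltr01 _.
    rewrite -(subnKC Jj) cos_extremumD; apply: le_trans J1 _.
    by rewrite lerDl mulr_ge0 // divr_ge0 ?pi_ge0 // ltW.
  rewrite -cP // /u uE //.
  (* The envelope never vanishes for [t > 0], so [u] and the perturbed cosine have the same zeros in
     the cell. *)
  have DN0 : expR (a * t) * t ^+ k * H nu0 != 0.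
    by rewrite !mulf_neq0 ?expf_neq0 ?gt_eqF ?expR_gt0.
  split; last by move=> ->; rewrite mulr0.
  by move/eqP; rewrite mulf_eq0 (negbTE DN0) => /eqP.
have ufin T : finite_set [set t | 0 <= t <= T /\ u t = 0].
  apply: finite_zeros; last exact: (cells_not_eventually0 Omega0 ucells).
  by apply: geometric_derivatives_sum => nu; exact: geometric_derivatives_mode.
have [D uD] := zero_count_bounded_discrepancy Omega0 J1 ucells ufin.
exact: bounded_discrepancy_cvg uD.
Qed.
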